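(* Let $(a_n)_{n\ge 1}$ be a sequence of complex numbers such that the Dirichlet series $f(s)=\sum_{n=1}^\infty a_n n^{-s}$ has abscissa of absolute convergence equal to $0$. Write $a_n=|a_n|e^{i\theta_n}$ with $\theta_n\in\mathbb{R}$. If there exists $\gamma>0$ such that $\cos(\theta_n)\ge\gamma$ for all $n$, then $f$ does not extend holomorphically to a neighborhood of $s=0$.
   Context: The abscissa of absolute convergence of $\sum a_n n^{-s}$ is $\sigma_a=\inf\{\sigma\in\mathbb{R}:\sum a_n n^{-s}\text{ converges absolutely for all } s \text{ with } \Re s>\sigma\}$. When $\sigma_a=0$, $f$ is holomorphic on $\Omega_0=\{s\in\mathbb{C}:\Re s>0\}$; $f$ extends holomorphically to a neighborhood of $s=0$ if there are $r>0$ and a holomorphic function on $\Omega_0\cup\{|s|<r\}$ which agrees with $f$ on $\Omega_0$. *)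

(* Defs.v *)
From Stdlib Require Import Reals Lra.
From Coquelicot Require Import Coquelicot.
Open Scope R_scope.

Definition cexp (z : C) : C :=
  (exp (Re z) * cos (Im z), exp (Re z) * sin (Im z)).

(** [n ^ (- s)] with the real logarithm; only meaningful for [1 <= n]. *)
Definition npow_opp (n : nat) (s : C) : C :=
  cexp (Copp s * RtoC (ln (INR n)))%C.

(** A sequence [(a_n)_{n >= 1}] is given by [a : nat -> C] whose value at [0]
    is ignored: the [k]-th term of the series is the one of index [n = S k]. *)
Definition dirichlet_term (a : nat -> C) (s : C) (k : nat) : C :=
  (a (S k) * npow_opp (S k) s)%C.

Definition abs_convergent (a : nat -> C) (s : C) : Prop :=
  ex_series (fun k => Cmod (dirichlet_term a s k)).

Definition abscissa_abs (a : nat -> C) : Rbar :=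
  Glb_Rbar (fun sigma : R => forall s : C, sigma < Re s -> abs_convergent a s).

(** [Series] is real-valued, so the sum is taken componentwise;
    see [dirichlet_series_unique]. *)
Definition dirichlet_series (a : nat -> C) (s : C) : C :=
  (Series (fun k => Re (dirichlet_term a s k)),
   Series (fun k => Im (dirichlet_term a s k))).

Definition Omega0 (s : C) : Prop := 0 < Re s.

(** Functions on a subset of [C] are represented by total functions; [U] is
    meant to be open, so that [ex_derive] only depends on the values on [U]. *)
Definition holomorphic_on (U : C -> Prop) (g : C -> C) : Prop :=
  forall s : C, U s -> ex_derive (K := C_AbsRing) (V := C_NormedModule) g s.

Definition extends_holomorphically_at_0 (f : C -> C) : Prop :=
  exists r : R, 0 < r /\
  exists g : C -> C,
    holomorphic_on (fun s => Omega0 s \/ Cmod s < r) g /\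
    (forall s : C, Omega0 s -> g s = f s).

Lemma dirichlet_series_unique (a : nat -> C) (s l : C) :
  is_series (K := C_AbsRing) (V := C_NormedModule) (dirichlet_term a s) l ->
  dirichlet_series a s = l.
Proof.
intros H.
assert (E : forall n, sum_n (dirichlet_term a s) n
  = (sum_n (fun k => Re (dirichlet_term a s k)) n,
     sum_n (fun k => Im (dirichlet_term a s k)) n)).
{ induction n as [|n IH].
  - rewrite !sum_O. apply surjective_pairing.
  - rewrite !sum_Sn, IH. reflexivity. }
assert (HR : is_series (fun k => Re (dirichlet_term a s k)) (Re l)).
{ apply filterlim_locally. intros eps.
  generalize (proj1 (filterlim_locally _ _) H eps).
  apply filter_imp. intros n Hn. rewrite E in Hn. exact (proj1 Hn). }
assert (HI : is_series (fun k => Im (dirichlet_term a s k)) (Im l)).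
{ apply filterlim_locally. intros eps.
  generalize (proj1 (filterlim_locally _ _) H eps).
  apply filter_imp. intros n Hn. rewrite E in Hn. exact (proj2 Hn). }
unfold dirichlet_series.
rewrite (is_series_unique _ _ HR), (is_series_unique _ _ HI).
symmetry; apply surjective_pairing.
Qed.

(* Main.v *)
Require Import Defs.
From Stdlib Require Import Reals ZArith Lra Lia Psatz Classical.
From Coquelicot Require Import Coquelicot.
Open Scope R_scope.

(** This is Landau's argument. Suppose [g] extends the series to [|s| < r] and
    take [R > 1] with [R^2 = 1 + r^2 / 2], so that [g] is holomorphic near the
    closed disc of radius [R] around [1]. By Goursat's argument the [k]-th
    Fourier coefficient of [g] on circles around [1] scales as the [k]-th power of
    the radius; on small circles it can be computed from the Dirichlet series,
    whence, with [L_n = ln n],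
    [sum_n |a_n| cos theta_n n^-1 L_n^k / k! <= M R^-k] for all [k].
    The terms are nonnegative, so for [1 < y < R] one may multiply by [y^k], sum
    over [k] and exchange the sums: [sum_n |a_n| cos theta_n n^(y - 1)] is
    finite. As [cos theta_n >= gamma], the abscissa is at most [1 - y < 0]. *)

(** * Goursat's theorem on rectangles *)

Lemma differentiable_continuous_l (f : R -> R -> R) (x y l m : R) :
  differentiable_pt_lim f x y l m -> continuous (fun s => f s y) x.
Proof.
intros H. apply (ex_derive_continuous (fun s => f s y)).
exists (l * 1 + m * 0). apply is_derive_Reals.
apply (derivable_pt_lim_comp_2d f (fun s => s) (fun _ => y)); trivial.
- apply derivable_pt_lim_id.
- apply derivable_pt_lim_const.
Qed.

Lemma differentiable_continuous_r (f : R -> R -> R) (x y l m : R) :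
  differentiable_pt_lim f x y l m -> continuous (fun t => f x t) y.
Proof.
intros H. apply (ex_derive_continuous (fun t => f x t)).
exists (l * 0 + m * 1). apply is_derive_Reals.
apply (derivable_pt_lim_comp_2d f (fun _ => x) (fun t => t)); trivial.
- apply derivable_pt_lim_const.
- apply derivable_pt_lim_id.
Qed.

(** The shared [l] is the equation u_x = v_y, the one of the two Cauchy-Riemann equations that makes
    [(u, - v)] divergence-free; it governs the imaginary part of the contour integral of
    [u + i v]. *)
Definition divergence_free (u v : R -> R -> R) (x y : R) : Prop :=
  exists l m n, differentiable_pt_lim u x y l m /\ differentiable_pt_lim v x y n l.

Definition divergence_free_on (u v : R -> R -> R) (a b c d : R) : Prop :=
  forall x y, a <= x <= b -> c <= y <= d -> divergence_free u v x y.

(** The flux of the field [(u, - v)] through the boundary of [[a, b] x [c, d]]. *)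
Definition flux (u v : R -> R -> R) (a b c d : R) : R :=
  (RInt (u b) c d - RInt (u a) c d)
  - (RInt (fun x => v x d) a b - RInt (fun x => v x c) a b).

Lemma divergence_free_ex_RInt_u (u v : R -> R -> R) (a b c d x p q : R) :
  divergence_free_on u v a b c d -> a <= x <= b -> c <= p <= q -> q <= d ->
  ex_RInt (u x) p q.
Proof.
intros H Hx Hp Hq. apply (ex_RInt_continuous (V := R_CompleteNormedModule)).
intros t Ht. rewrite Rmin_left, Rmax_right in Ht by lra.
destruct (H x t) as (l & m & n & Hu & _); try lra.
exact (differentiable_continuous_r _ _ _ _ _ Hu).
Qed.

Lemma divergence_free_ex_RInt_v (u v : R -> R -> R) (a b c d y p q : R) :
  divergence_free_on u v a b c d -> c <= y <= d -> a <= p <= q -> q <= b ->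
  ex_RInt (fun x => v x y) p q.
Proof.
intros H Hx Hp Hq. apply (ex_RInt_continuous (V := R_CompleteNormedModule)).
intros t Ht. rewrite Rmin_left, Rmax_right in Ht by lra.
destruct (H t y) as (l & m & n & _ & Hv); try lra.
exact (differentiable_continuous_l _ _ _ _ _ Hv).
Qed.

Lemma flux_split (u v : R -> R -> R) (a m b c n d : R) :
  divergence_free_on u v a b c d -> a <= m <= b -> c <= n <= d ->
  flux u v a b c d = flux u v a m c n + flux u v m b c n
                     + flux u v a m n d + flux u v m b n d.
Proof.
intros H Hm Hn.
assert (U : forall x, a <= x <= b -> RInt (u x) c d = RInt (u x) c n + RInt (u x) n d).
{ intros x Hx. symmetry. apply (RInt_Chasles (V := R_CompleteNormedModule));
    eapply divergence_free_ex_RInt_u; try exact H; lra. }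
assert (W : forall y, c <= y <= d -> RInt (fun x => v x y) a b
   = RInt (fun x => v x y) a m + RInt (fun x => v x y) m b).
{ intros y Hy. symmetry. apply (RInt_Chasles (V := R_CompleteNormedModule));
    eapply divergence_free_ex_RInt_v; try exact H; lra. }
unfold flux. rewrite (U a), (U b), (W c), (W d) by lra. ring.
Qed.

Lemma RInt_between (f : R -> R) (a b lo hi : R) :
  a <= b -> ex_RInt f a b -> (forall t, a <= t <= b -> lo <= f t <= hi) ->
  (b - a) * lo <= RInt f a b <= (b - a) * hi.
Proof.
intros Hab Hf H.
rewrite <- (RInt_const a b lo : _ = (b - a) * lo).
rewrite <- (RInt_const a b hi : _ = (b - a) * hi).
split; apply RInt_le; trivial; try apply ex_RInt_const; intros; apply H; lra.
Qed.

(** The affine part has zero flux: both pairs of opposite sides give [l (b - a) (d - c)], with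
    opposite signs. The error is at most [e * D] on each of four sides of length at most [D]. *)
Lemma flux_linear_approx (u v : R -> R -> R) (a b c d x0 y0 l m n e D : R) :
  a <= b -> c <= d -> b - a <= D -> d - c <= D ->
  divergence_free_on u v a b c d ->
  (forall x y, a <= x <= b -> c <= y <= d ->
     Rabs (u x y - u x0 y0 - (l * (x - x0) + m * (y - y0))) <= e * D /\
     Rabs (v x y - v x0 y0 - (n * (x - x0) + l * (y - y0))) <= e * D) ->
  Rabs (flux u v a b c d) <= 4 * e * D ^ 2.
Proof.
intros Hab Hcd HbD HdD HU H.
assert (He : 0 <= e * D).
{ destruct (H a c) as [H1 _]; try lra.
  eapply Rle_trans; [apply Rabs_pos | exact H1]. }
assert (B1 : (d - c) * (l * (b - a) - 2 * (e * D))
   <= RInt (fun t => u b t - u a t) c d <= (d - c) * (l * (b - a) + 2 * (e * D))).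
{ apply RInt_between; trivial.
  - apply (ex_RInt_minus (V := R_NormedModule) (u b) (u a));
      eapply divergence_free_ex_RInt_u; try exact HU; lra.
  - intros t Ht. destruct (H a t) as [H1 _]; try lra.
    destruct (H b t) as [H2 _]; try lra.
    apply Rabs_le_between in H1. apply Rabs_le_between in H2. lra. }
assert (B2 : (b - a) * (l * (d - c) - 2 * (e * D))
   <= RInt (fun x => v x d - v x c) a b <= (b - a) * (l * (d - c) + 2 * (e * D))).
{ apply RInt_between; trivial.
  - apply (ex_RInt_minus (V := R_NormedModule) (fun x => v x d) (fun x => v x c));
      eapply divergence_free_ex_RInt_v; try exact HU; lra.
  - intros t Ht. destruct (H t c) as [_ H1]; try lra.
    destruct (H t d) as [_ H2]; try lra.
    apply Rabs_le_between in H1. apply Rabs_le_between in H2. lra. }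
rewrite (RInt_minus (V := R_CompleteNormedModule) (u b) (u a)) in B1
  by (eapply divergence_free_ex_RInt_u; try exact HU; lra).
rewrite (RInt_minus (V := R_CompleteNormedModule) (fun x => v x d) (fun x => v x c)) in B2
  by (eapply divergence_free_ex_RInt_v; try exact HU; lra).
unfold minus, plus, opp in B1, B2; simpl in B1, B2.
assert (M1 : (d - c) * (e * D) <= D * (e * D)) by (apply Rmult_le_compat_r; lra).
assert (M2 : (b - a) * (e * D) <= D * (e * D)) by (apply Rmult_le_compat_r; lra).
unfold flux. apply Rabs_le.
replace (4 * e * D ^ 2) with (4 * (D * (e * D))) by ring. lra.
Qed.

Lemma divergence_free_on_sub (u v : R -> R -> R) (a b c d a' b' c' d' : R) :
  divergence_free_on u v a b c d -> a <= a' -> b' <= b -> c <= c' -> d' <= d ->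
  divergence_free_on u v a' b' c' d'.
Proof. intros H ? ? ? ? x y ? ?. apply H; lra. Qed.

(** Goursat's bisection: no continuity of the partial derivatives is assumed. *)
Lemma flux_zero (u v : R -> R -> R) (a b c d : R) :
  a <= b -> c <= d -> divergence_free_on u v a b c d -> flux u v a b c d = 0.
Proof.
intros Hab Hcd H.
pose (w n := (b - a) / 2 ^ n). pose (h n := (d - c) / 2 ^ n).
pose (F n (p : R * R) := Rabs (flux u v (fst p) (fst p + w n) (snd p) (snd p + h n))).
(* Here [p] is the lower left corner of a rectangle of generation [n]. The first of its quarters
   with at least a quarter of the absolute flux is taken, with [q4] as the default. *)
pose (next n (p : R * R) :=
  let q1 := (fst p, snd p) in let q2 := (fst p + w (S n), snd p) in
  let q3 := (fst p, snd p + h (S n)) in let q4 := (fst p + w (S n), snd p + h (S n)) in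
  if Rle_dec (F n p / 4) (F (S n) q1) then q1 else
  if Rle_dec (F n p / 4) (F (S n) q2) then q2 else
  if Rle_dec (F n p / 4) (F (S n) q3) then q3 else q4).
pose (s := fix s n := match n with O => (a, c) | S n => next n (s n) end).
assert (P2 : forall n, 0 < 2 ^ n) by (intros; apply pow_lt; lra).
assert (wS : forall n, w n = 2 * w (S n)).
{ intros n. unfold w. simpl. field. specialize (P2 n). lra. }
assert (hS : forall n, h n = 2 * h (S n)).
{ intros n. unfold h. simpl. field. specialize (P2 n). lra. }
assert (w0 : forall n, 0 <= w n).
{ intros n. apply Rdiv_le_0_compat; trivial; lra. }
assert (h0 : forall n, 0 <= h n).
{ intros n. apply Rdiv_le_0_compat; trivial; lra. }
assert (s1 : forall n, (fst (s (S n)) = fst (s n) \/ fst (s (S n)) = fst (s n) + w (S n))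
   /\ (snd (s (S n)) = snd (s n) \/ snd (s (S n)) = snd (s n) + h (S n))).
{ intros n. simpl. unfold next.
  repeat destruct Rle_dec; simpl; auto. }
assert (sb : forall n, a <= fst (s n) /\ fst (s n) + w n <= b
   /\ c <= snd (s n) /\ snd (s n) + h n <= d).
{ induction n as [|n IH].
  - unfold w, h. simpl. lra.
  - specialize (s1 n). specialize (wS n). specialize (hS n).
    specialize (w0 (S n)). specialize (h0 (S n)).
    destruct s1 as [[-> | ->] [-> | ->]]; lra. }
assert (sF : forall n, F n (s n) / 4 <= F (S n) (s (S n))).
{ intros n. simpl. unfold next.
  repeat destruct Rle_dec; trivial.
  (* Only the default [q4] is left: when three quarters each carry less than a fourth of the flux,
     the last one carries more. *)
  cut (F n (s n) <= F (S n) (fst (s n), snd (s n)) + F (S n) (fst (s n) + w (S n), snd (s n))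
     + F (S n) (fst (s n), snd (s n) + h (S n)) + F (S n) (fst (s n) + w (S n), snd (s n) + h (S n))).
  { lra. }
  unfold F; simpl. specialize (sb n). rewrite (wS n), (hS n) in sb |- *. specialize (w0 (S n)). specialize (h0 (S n)).
  rewrite (flux_split _ _ (fst (s n)) (fst (s n) + w (S n)) _ (snd (s n)) (snd (s n) + h (S n))); try lra.
  - replace (fst (s n) + 2 * w (S n)) with (fst (s n) + w (S n) + w (S n)) by ring.
    replace (snd (s n) + 2 * h (S n)) with (snd (s n) + h (S n) + h (S n)) by ring.
    eapply Rle_trans; [apply Rabs_triang |]. apply Rplus_le_compat_r.
    eapply Rle_trans; [apply Rabs_triang |]. apply Rplus_le_compat_r.
    apply Rabs_triang.
  - apply (divergence_free_on_sub _ _ _ _ _ _ _ _ _ _ H); lra. }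
assert (sF' : forall n, F O (s O) / 4 ^ n <= F n (s n)).
{ induction n as [|n IH].
  - simpl. lra.
  - apply Rle_trans with (F n (s n) / 4); trivial.
    assert (0 < 4 ^ n) by (apply pow_lt; lra).
    replace (F O (s O) / 4 ^ S n) with (F O (s O) / 4 ^ n / 4) by (simpl; field; lra).
    lra. }
pose (D := Rmax (b - a) (d - c)).
assert (HD1 : b - a <= D) by apply Rmax_l. assert (HD2 : d - c <= D) by apply Rmax_r.
assert (L : forall X : R, is_lim_seq (fun n => X / 2 ^ n) 0).
{ intros X. apply is_lim_seq_ext with (fun n => X * (/ 2) ^ n).
  - intros n. rewrite pow_inv. reflexivity.
  - replace (Finite 0) with (Rbar_mult X 0) by (simpl; f_equal; ring).
    apply is_lim_seq_scal_l. apply is_lim_seq_geom. rewrite Rabs_pos_eq; lra. }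
(* Nested intervals: left ends increase, right ends decrease and lengths tend to 0, so all the
   intervals share a point. *)
assert (N : forall (z o : nat -> R), (forall n, 0 <= o n) ->
   (forall n, o n = 2 * o (S n)) -> is_lim_seq o 0 ->
   (forall n, z (S n) = z n \/ z (S n) = z n + o (S n)) ->
   exists p, forall n, z n <= p <= z n + o n).
{ intros z o o0 oS ol zS.
  assert (z1 : forall n, z n <= z (S n)).
  { intros n. specialize (zS n). specialize (o0 (S n)). lra. }
  assert (z2 : forall n, z (S n) + o (S n) <= z n + o n).
  { intros n. specialize (zS n). specialize (o0 (S n)). rewrite (oS n). lra. }
  destruct (ex_lim_seq_adj z (fun n => z n + o n)) as (E1 & E2 & E); trivial.
  { apply is_lim_seq_ext with o; trivial. intros n; ring. }
  destruct E1 as [p Hp]. destruct E2 as [q Hq].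
  rewrite (is_lim_seq_unique _ _ Hp), (is_lim_seq_unique _ _ Hq) in E.
  injection E as <-. exists p. intros n. split.
  - exact (is_lim_seq_incr_compare _ _ Hp z1 n).
  - exact (is_lim_seq_decr_compare _ _ Hq z2 n). }
destruct (N (fun n => fst (s n)) w) as [p Hp]; trivial.
{ apply L. } { intros n; apply s1. }
destruct (N (fun n => snd (s n)) h) as [q Hq]; trivial.
{ apply L. } { intros n; apply s1. }
clear N.
assert (Hpq : a <= p <= b /\ c <= q <= d).
{ specialize (Hp O); specialize (Hq O). unfold w, h in *; simpl in *. lra. }
destruct (H p q) as (l & m & n & Hu & Hv); try lra.
assert (Z : F O (s O) <= 0).
{ apply Rnot_lt_le. intros Hpos.
  assert (D0 : 0 <= D) by lra.
  (* With this [e] the absolute flux is [8 e (D^2 + 1)], above the bound [4 e D^2] obtained below;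
     the summand 1 covers [D = 0]. *)
  pose (e := F O (s O) / (8 * (D ^ 2 + 1))).
  assert (D20 : 0 <= D ^ 2) by (apply pow_le; trivial).
  assert (e0 : 0 < e) by (apply Rdiv_lt_0_compat; lra).
  destruct (Hu (mkposreal e e0)) as [d1 H1]. destruct (Hv (mkposreal e e0)) as [d2 H2].
  simpl in H1, H2.
  assert (Hd : 0 < Rmin d1 d2) by (apply Rmin_pos; apply cond_pos).
  (* At generation [k] the rectangle is so small that both linear approximations at [(p, q)] are
     valid on all of it. *)
  destruct (proj2 (is_lim_seq_spec _ _) (L D) (mkposreal _ Hd)) as [k Hk].
  specialize (Hk k (Nat.le_refl k)). simpl in Hk.
  specialize (Hp k). specialize (Hq k). specialize (sb k). specialize (sF' k).
  specialize (P2 k). specialize (w0 k). specialize (h0 k).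
  assert (wD : w k <= D / 2 ^ k).
  { apply Rmult_le_compat_r; trivial. left; apply Rinv_0_lt_compat; lra. }
  assert (hD : h k <= D / 2 ^ k).
  { apply Rmult_le_compat_r; trivial. left; apply Rinv_0_lt_compat; lra. }
  pose proof (Rmin_l d1 d2). pose proof (Rmin_r d1 d2).
  rewrite Rminus_0_r, Rabs_pos_eq in Hk by lra.
  assert (B : F k (s k) <= 4 * e * (D / 2 ^ k) ^ 2).
  { apply flux_linear_approx with p q l m n; try lra.
    - apply (divergence_free_on_sub _ _ _ _ _ _ _ _ _ _ H); lra.
    - intros x y Hx Hy.
      assert (Ax : Rabs (x - p) <= D / 2 ^ k) by (apply Rabs_le; lra).
      assert (Ay : Rabs (y - q) <= D / 2 ^ k) by (apply Rabs_le; lra).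
      assert (M : e * Rmax (Rabs (x - p)) (Rabs (y - q)) <= e * (D / 2 ^ k)).
      { apply Rmult_le_compat_l; [lra | apply Rmax_lub; trivial]. }
      split; (eapply Rle_trans; [| exact M]); [apply H1 | apply H2]; lra. }
  assert (P4 : 4 ^ k = 2 ^ k * 2 ^ k).
  { rewrite <- Rpow_mult_distr. f_equal. }
  replace (4 * e * (D / 2 ^ k) ^ 2) with (4 * e * D ^ 2 / 4 ^ k) in B
    by (rewrite P4; field; lra).
  (* The flux loses at most a factor 4 per generation and the bound is quadratic in the size, so
     [4 ^ k] cancels. *)
  assert (B' : F O (s O) <= 4 * e * D ^ 2).
  { apply Rmult_le_reg_r with (/ 4 ^ k).
    - apply Rinv_0_lt_compat. rewrite P4. nra.
    - exact (Rle_trans _ _ _ sF' B). }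
  assert (E : F O (s O) = e * (8 * (D ^ 2 + 1))) by (unfold e; field; lra).
  nra. }
assert (Z' : Rabs (flux u v a b c d) <= 0).
{ unfold F, w, h in Z. simpl in Z.
  replace (a + (b - a) / 1) with b in Z by field.
  replace (c + (d - c) / 1) with d in Z by field. exact Z. }
apply Rabs_eq_0. apply Rle_antisym; trivial. apply Rabs_pos.
Qed.

(** * Integrals over circles *)

Definition cauchy_riemann (u v : R -> R -> R) (x y : R) : Prop :=
  exists al be, differentiable_pt_lim u x y al (- be) /\ differentiable_pt_lim v x y be al.

Lemma cauchy_riemann_divergence_free (u v : R -> R -> R) (x y : R) :
  cauchy_riemann u v x y -> divergence_free u v x y.
Proof. intros (al & be & Hu & Hv). exists al, (- be), be. split; trivial. Qed.

Lemma Rabs_Re_Im_le_Cmod (z : C) : Rabs (Re z) <= Cmod z /\ Rabs (Im z) <= Cmod z.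
Proof.
split; (eapply Rle_trans; [| apply Rmax_Cmod]); [apply Rmax_l | apply Rmax_r].
Qed.

(** Multiplication by the complex derivative [l] is a real matrix of Cauchy-Riemann shape, with
    entries built from [Re l] and [Im l]. The factors [sqrt 2] compare the modulus with the maximum
    norm of [differentiable_pt_lim]. *)
Lemma ex_derive_cauchy_riemann (g : C -> C) (x y : R) :
  ex_derive (K := C_AbsRing) (V := C_NormedModule) g (x, y) ->
  cauchy_riemann (fun x y => Re (g (x, y))) (fun x y => Im (g (x, y))) x y.
Proof.
intros [l [_ H]].
specialize (H (x, y) (fun P H => H)).
assert (S2 : 0 < sqrt 2) by (apply sqrt_lt_R0; lra).
assert (H' : forall eps : posreal, locally_2d (fun u v =>
  Cmod (g (u, v) - g (x, y) - ((u, v) - (x, y)) * l)%C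
    <= eps * Rmax (Rabs (u - x)) (Rabs (v - y))) x y).
{ intros eps.
  assert (e0 : 0 < eps / sqrt 2).
  { apply Rdiv_lt_0_compat; trivial. apply cond_pos. }
  destruct (H (mkposreal _ e0)) as [d Hd].
  assert (d0 : 0 < d / sqrt 2).
  { apply Rdiv_lt_0_compat; trivial. apply cond_pos. }
  exists (mkposreal _ d0). intros u v Hu Hv. simpl in Hu, Hv.
  assert (B : Cmod ((u, v) - (x, y))%C <= sqrt 2 * Rmax (Rabs (u - x)) (Rabs (v - y)))
    by apply Cmod_2Rmax.
  eapply Rle_trans.
  - apply (Hd (u, v)).
    change (Cmod ((u, v) - (x, y))%C < d).
    eapply Rle_lt_trans; [exact B |].
    replace (pos d) with (sqrt 2 * (d / sqrt 2)) by (field; lra).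
    apply Rmult_lt_compat_l; trivial. apply Rmax_lub_lt; trivial.
  - change (eps / sqrt 2 * Cmod ((u, v) - (x, y))%C
      <= eps * Rmax (Rabs (u - x)) (Rabs (v - y))).
    replace (eps * Rmax (Rabs (u - x)) (Rabs (v - y)))
      with (eps / sqrt 2 * (sqrt 2 * Rmax (Rabs (u - x)) (Rabs (v - y)))) by (field; lra).
    apply Rmult_le_compat_l; [lra | exact B]. }
exists (Re l), (Im l). split; intros eps; destruct (H' eps) as [d Hd];
  exists d; intros u v Hu Hv; (eapply Rle_trans; [| exact (Hd u v Hu Hv)]).
- eapply Rle_trans; [| exact (proj1 (Rabs_Re_Im_le_Cmod _))].
  right; f_equal; unfold Re, Im; simpl; ring.
- eapply Rle_trans; [| exact (proj2 (Rabs_Re_Im_le_Cmod _))].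
  right; f_equal; unfold Re, Im; simpl; ring.
Qed.

(** * Cauchy-Riemann pairs: products, compositions and the exponential *)

Lemma differentiable_pt_lim_linear (p q c x y : R) :
  differentiable_pt_lim (fun x y => p * x + q * y + c) x y p q.
Proof.
intros eps. exists (mkposreal 1 Rlt_0_1). intros u v _ _.
replace (_ - _) with 0 by ring. rewrite Rabs_R0.
apply Rmult_le_pos; [left; apply cond_pos |].
eapply Rle_trans; [apply Rabs_pos | apply Rmax_l].
Qed.

Lemma differentiable_pt_lim_Rmult (x y : R) : differentiable_pt_lim Rmult x y y x.
Proof.
intros eps. exists eps. intros u v Hu _.
replace (_ - _) with ((u - x) * (v - y)) by ring. rewrite Rabs_mult.
apply Rmult_le_compat; try apply Rabs_pos; [lra | apply Rmax_r].
Qed.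

Lemma differentiable_pt_lim_mult (f g : R -> R -> R) (x y l m l' m' : R) :
  differentiable_pt_lim f x y l m -> differentiable_pt_lim g x y l' m' ->
  differentiable_pt_lim (fun x y => f x y * g x y) x y
    (g x y * l + f x y * l') (g x y * m + f x y * m').
Proof.
intros. apply (differentiable_pt_lim_comp Rmult); trivial.
apply differentiable_pt_lim_Rmult.
Qed.

Lemma differentiable_pt_lim_lin_comb (p q c : R) (f g : R -> R -> R) (x y l m l' m' : R) :
  differentiable_pt_lim f x y l m -> differentiable_pt_lim g x y l' m' ->
  differentiable_pt_lim (fun x y => p * f x y + q * g x y + c) x y
    (p * l + q * l') (p * m + q * m').
Proof.
intros. apply (differentiable_pt_lim_comp (fun a b => p * a + q * b + c)); trivial.
apply differentiable_pt_lim_linear.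
Qed.

Lemma differentiable_pt_lim_change (f g : R -> R -> R) (x y l m l' m' : R) :
  differentiable_pt_lim f x y l m -> (forall x y, f x y = g x y) ->
  l = l' -> m = m' -> differentiable_pt_lim g x y l' m'.
Proof.
intros H E <- <-. apply differentiable_pt_lim_ext with f; trivial.
exists (mkposreal 1 Rlt_0_1). intros; apply E.
Qed.

Lemma cauchy_riemann_mult (u1 v1 u2 v2 : R -> R -> R) (x y : R) :
  cauchy_riemann u1 v1 x y -> cauchy_riemann u2 v2 x y ->
  cauchy_riemann (fun x y => u1 x y * u2 x y - v1 x y * v2 x y)
                 (fun x y => u1 x y * v2 x y + v1 x y * u2 x y) x y.
Proof.
intros (a1 & b1 & Hu1 & Hv1) (a2 & b2 & Hu2 & Hv2).
exists (u1 x y * a2 + u2 x y * a1 - v1 x y * b2 - v2 x y * b1),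
  (u1 x y * b2 + v2 x y * a1 + v1 x y * a2 + u2 x y * b1).
split; eapply differentiable_pt_lim_change.
- apply (differentiable_pt_lim_lin_comb 1 (-1) 0);
    [exact (differentiable_pt_lim_mult _ _ _ _ _ _ _ _ Hu1 Hu2)
    |exact (differentiable_pt_lim_mult _ _ _ _ _ _ _ _ Hv1 Hv2)].
- intros; simpl; ring.
- ring.
- ring.
- apply (differentiable_pt_lim_lin_comb 1 1 0);
    [exact (differentiable_pt_lim_mult _ _ _ _ _ _ _ _ Hu1 Hv2)
    |exact (differentiable_pt_lim_mult _ _ _ _ _ _ _ _ Hv1 Hu2)].
- intros; simpl; ring.
- ring.
- ring.
Qed.

Lemma cauchy_riemann_comp (u v X Y : R -> R -> R) (x y : R) :
  cauchy_riemann u v (X x y) (Y x y) -> cauchy_riemann X Y x y ->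
  cauchy_riemann (fun x y => u (X x y) (Y x y)) (fun x y => v (X x y) (Y x y)) x y.
Proof.
intros (a1 & b1 & Hu1 & Hv1) (a2 & b2 & Hu2 & Hv2).
exists (a1 * a2 - b1 * b2), (b1 * a2 + a1 * b2). split.
- eapply differentiable_pt_lim_change;
    [exact (differentiable_pt_lim_comp _ _ _ _ _ _ _ _ _ _ _ Hu1 Hu2 Hv2) | reflexivity | ring | ring].
- eapply differentiable_pt_lim_change;
    [exact (differentiable_pt_lim_comp _ _ _ _ _ _ _ _ _ _ _ Hv1 Hu2 Hv2) | reflexivity | ring | ring].
Qed.

Lemma differentiable_pt_lim_snd (h : R -> R) (x y l : R) :
  derivable_pt_lim h y l -> differentiable_pt_lim (fun _ y => h y) x y 0 l.
Proof.
intros H. eapply differentiable_pt_lim_change.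
- apply (differentiable_pt_lim_comp (fun a _ => h a)
    (fun x y => 0 * x + 1 * y + 0) (fun x y => 0 * x + 0 * y + 0)).
  + apply differentiable_pt_lim_proj1_0.
    replace (0 * x + 1 * y + 0) with y by ring. exact H.
  + apply differentiable_pt_lim_linear.
  + apply differentiable_pt_lim_linear.
- intros; simpl; f_equal; ring.
- ring.
- ring.
Qed.

(** These are the real and imaginary parts of [c + exp (k z)]. *)
Lemma cauchy_riemann_exp (c k x y : R) :
  cauchy_riemann (fun x y => c + exp (k * x) * cos (k * y))
                 (fun x y => exp (k * x) * sin (k * y)) x y.
Proof.
assert (He : derivable_pt_lim (fun x => exp (k * x)) x (k * exp (k * x))).
{ apply is_derive_Reals. auto_derive; trivial. ring. }
assert (Hc : derivable_pt_lim (fun x => cos (k * x)) y (- k * sin (k * y))).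
{ apply is_derive_Reals. auto_derive; trivial. ring. }
assert (Hs : derivable_pt_lim (fun x => sin (k * x)) y (k * cos (k * y))).
{ apply is_derive_Reals. auto_derive; trivial. ring. }
apply (differentiable_pt_lim_proj1_0 _ _ y) in He.
apply (differentiable_pt_lim_snd _ x) in Hc, Hs.
pose proof (differentiable_pt_lim_mult _ _ _ _ _ _ _ _ He Hc) as M1.
pose proof (differentiable_pt_lim_mult _ _ _ _ _ _ _ _ He Hs) as M2.
exists (k * exp (k * x) * cos (k * y)), (k * exp (k * x) * sin (k * y)).
split; eapply differentiable_pt_lim_change.
(* The constant [c] is added by means of the combination [1 * M1 + 0 * M1 + c]. *)
- exact (differentiable_pt_lim_lin_comb 1 0 c _ _ _ _ _ _ _ _ M1 M1).
- intros; simpl; ring.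
- simpl; ring.
- simpl; ring.
- exact M2.
- reflexivity.
- simpl; ring.
- simpl; ring.
Qed.

(** Real and imaginary parts of [w^(-k) g (c + w)] for [w = exp (x + i t)]; the
    factors [1 *] and summands [0 +] are there to match [cauchy_riemann_exp]. *)
Definition circle_re (g : C -> C) (c k x t : R) : R :=
  Re (Cmult (g (c + exp (1 * x) * cos (1 * t), exp (1 * x) * sin (1 * t)))
            (0 + exp (- k * x) * cos (- k * t), exp (- k * x) * sin (- k * t))).

Definition circle_im (g : C -> C) (c k x t : R) : R :=
  Im (Cmult (g (c + exp (1 * x) * cos (1 * t), exp (1 * x) * sin (1 * t)))
            (0 + exp (- k * x) * cos (- k * t), exp (- k * x) * sin (- k * t))).

Lemma circle_cauchy_riemann (U : C -> Prop) (g : C -> C) (c k x t : R) :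
  holomorphic_on U g -> U (c + exp x * cos t, exp x * sin t) ->
  cauchy_riemann (circle_re g c k) (circle_im g c k) x t.
Proof.
intros H HU.
apply (cauchy_riemann_mult _ _ _ _ x t) with (2 := cauchy_riemann_exp 0 (- k) x t).
apply (cauchy_riemann_comp (fun x y => Re (g (x, y))) (fun x y => Im (g (x, y))) _ _ x t)
  with (2 := cauchy_riemann_exp c 1 x t).
apply ex_derive_cauchy_riemann, H. rewrite !Rmult_1_l. exact HU.
Qed.

(** In the coordinates [x + i t] the integrand is holomorphic, and by [2 pi i]-periodicity
    the horizontal sides of the rectangle cancel. *)
Lemma circle_RInt_invariant (U : C -> Prop) (g : C -> C) (c x1 x2 : R) (k : nat) :
  x1 <= x2 -> holomorphic_on U g ->
  (forall x t, x1 <= x <= x2 -> U (c + exp x * cos t, exp x * sin t)) ->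
  RInt (circle_re g c (INR k) x1) 0 (2 * PI) = RInt (circle_re g c (INR k) x2) 0 (2 * PI).
Proof.
intros Hx Hg HU. pose proof PI_RGT_0.
assert (F : flux (circle_re g c (INR k)) (circle_im g c (INR k)) x1 x2 0 (2 * PI) = 0).
{ apply flux_zero; [trivial | lra |]. intros x t Ix _.
  apply cauchy_riemann_divergence_free. apply circle_cauchy_riemann with U; auto. }
unfold flux in F.
assert (E : forall x, circle_im g c (INR k) x (2 * PI) = circle_im g c (INR k) x 0).
{ intros x. unfold circle_im.
  replace (- INR k * (2 * PI)) with (- (0 + 2 * INR k * PI)) by ring.
  rewrite cos_neg, sin_neg, cos_period, sin_period.
  rewrite !Rmult_1_l, !Rmult_0_r, cos_2PI, sin_2PI, cos_0, sin_0, Ropp_0. reflexivity. }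
rewrite (RInt_ext (fun x => circle_im g c (INR k) x (2 * PI))
  (fun x => circle_im g c (INR k) x 0)) in F by (intros; apply E).
lra.
Qed.

(** * Termwise integration and moments of the exponential *)

Lemma is_series_sum_n_le (b : nat -> R) (l : R) (n : nat) :
  (forall k, 0 <= b k) -> is_series b l -> sum_n b n <= l.
Proof.
intros Hb H. apply (is_lim_seq_incr_compare (sum_n b) l); trivial.
intros m. rewrite sum_Sn. unfold plus; simpl. specialize (Hb (S m)). lra.
Qed.

(** Both [A - b] and [A + b] have nonnegative terms, so their partial sums do not exceed their sums;
    this bounds the tail of [b] from both sides. *)
Lemma is_series_tail_le (b A : nat -> R) (l : R) (n : nat) :
  (forall k, Rabs (b k) <= A k) -> ex_series A -> is_series b l ->
  Rabs (l - sum_n b n) <= Series A - sum_n A n.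
Proof.
intros Hb HA Hl. apply Series_correct in HA.
assert (B : forall k, - A k <= b k <= A k).
{ intros k. apply Rabs_le_between. apply Hb. }
pose proof (is_series_sum_n_le _ _ n (fun k => proj1 (Rminus_le_0 _ _) (proj2 (B k)))
  (is_series_minus _ _ _ _ HA Hl)) as H1.
assert (H2 : sum_n (fun k => plus (A k) (b k)) n <= plus (Series A) l).
{ apply is_series_sum_n_le.
  - intros k. unfold plus; simpl. specialize (B k). lra.
  - apply (is_series_plus A b); trivial. }
rewrite sum_n_plus in H2.
assert (E : sum_n (fun k => A k - b k) n = sum_n A n - sum_n b n).
{ clear. induction n as [|n IH]; [now rewrite !sum_O |].
  rewrite !sum_Sn, IH. unfold plus; simpl. ring. }
rewrite E in H1. unfold plus, opp in H1, H2; simpl in H1, H2.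
apply Rabs_le. lra.
Qed.

Lemma is_RInt_sum_n (f : nat -> R -> R) (a b : R) (n : nat) :
  (forall k, ex_RInt (f k) a b) ->
  is_RInt (fun t => sum_n (fun k => f k t) n) a b (sum_n (fun k => RInt (f k) a b) n).
Proof.
intros H. assert (H' : forall k, is_RInt (f k) a b (RInt (f k) a b)).
{ intros k. apply (RInt_correct (V := R_CompleteNormedModule)), H. }
induction n as [|n IH].
- rewrite sum_O. apply is_RInt_ext with (f O); trivial. intros; now rewrite sum_O.
- rewrite sum_Sn. eapply is_RInt_ext.
  2: { apply (is_RInt_plus (V := R_NormedModule)); [exact IH | exact (H' (S n))]. }
  intros; simpl. now rewrite sum_Sn.
Qed.

(** Weierstrass test: the tails are bounded by those of [A] uniformly in [t], so the integrated
    error is at most [b - a] times a tail of [A]. *)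
Lemma is_series_RInt (f : nat -> R -> R) (F : R -> R) (A : nat -> R) (a b : R) :
  a <= b -> (forall k, ex_RInt (f k) a b) -> ex_RInt F a b ->
  (forall k t, Rabs (f k t) <= A k) -> ex_series A ->
  (forall t, is_series (fun k => f k t) (F t)) ->
  is_series (fun k => RInt (f k) a b) (RInt F a b).
Proof.
intros Hab Hf HF HfA HA Hs.
assert (L : is_lim_seq (fun n => (b - a) * (Series A - sum_n A n)) 0).
{ replace (Finite 0) with (Rbar_mult (b - a) (Rbar_minus (Series A) (Series A))).
  2: { simpl; f_equal; ring. }
  apply is_lim_seq_scal_l.
  apply is_lim_seq_minus'.
  - apply is_lim_seq_const.
  - exact (Series_correct _ HA). }
assert (E : forall n, Rabs (sum_n (fun k => RInt (f k) a b) n - RInt F a b)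
   <= (b - a) * (Series A - sum_n A n)).
{ intros n. pose proof (is_RInt_sum_n f a b n Hf) as H.
  pose proof (is_RInt_minus (V := R_NormedModule) _ _ _ _ _ _ H
     (RInt_correct (V := R_CompleteNormedModule) _ _ _ HF)) as H2.
  pose proof (is_RInt_unique (V := R_CompleteNormedModule) _ _ _ _ H2) as E.
  change (minus (sum_n (fun k => RInt (f k) a b) n) (RInt F a b))
    with (sum_n (fun k => RInt (f k) a b) n - RInt F a b) in E.
  rewrite <- E.
  apply abs_RInt_le_const; trivial.
  - eexists; exact H2.
  - intros t _. pose proof (is_series_tail_le _ _ _ n (fun k => HfA k t) HA (Hs t)) as T.
    rewrite Rabs_minus_sym in T. exact T. }
apply (is_lim_seq_ext (fun n => RInt F a b + (sum_n (fun k => RInt (f k) a b) n - RInt F a b))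
  (sum_n (fun k => RInt (f k) a b)) (RInt F a b)).
{ intros; ring. }
replace (Finite (RInt F a b)) with (Finite (RInt F a b + 0)) by (f_equal; ring).
apply is_lim_seq_plus'; [apply is_lim_seq_const |].
apply is_lim_seq_abs_0.
apply is_lim_seq_le_le with (fun _ => 0) (fun n => (b - a) * (Series A - sum_n A n)); trivial.
- intros n. split; [apply Rabs_pos | apply E].
- apply is_lim_seq_const.
Qed.

(** The real part of [exp (i phi) exp (lam w) w^(-k)] for [w = exp (i t)]. *)
Definition moment_integrand (k phi lam t : R) : R :=
  exp (lam * cos t) * cos (lam * sin t - k * t + phi).

Lemma moment_integrand_continuity (k phi lam t : R) :
  continuity_2d_pt (moment_integrand k phi) lam t.
Proof.
assert (C1 : forall h : R -> R, (forall z, continuity_pt h z) ->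
   continuity_2d_pt (fun _ v => h v) lam t).
{ intros h Hh. apply continuity_1d_2d_pt_comp; trivial. apply continuity_2d_pt_id2. }
unfold moment_integrand. apply continuity_2d_pt_mult.
- apply continuity_1d_2d_pt_comp.
  + apply derivable_continuous_pt, derivable_pt_exp.
  + apply continuity_2d_pt_mult; [apply continuity_2d_pt_id1 |].
    apply C1. apply continuity_cos.
- apply continuity_1d_2d_pt_comp.
  + apply continuity_cos.
  + apply continuity_2d_pt_plus; [apply continuity_2d_pt_minus |];
      [apply continuity_2d_pt_mult | apply continuity_2d_pt_mult | apply continuity_2d_pt_const].
    * apply continuity_2d_pt_id1.
    * apply C1. apply continuity_sin.
    * apply continuity_2d_pt_const.
    * apply continuity_2d_pt_id2.
Qed.

Lemma ex_RInt_moment_integrand (k phi lam a b : R) :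
  ex_RInt (moment_integrand k phi lam) a b.
Proof.
apply (ex_RInt_continuous (V := R_CompleteNormedModule)). intros t _.
apply (ex_derive_continuous (moment_integrand k phi lam)).
unfold moment_integrand. auto_derive; trivial.
Qed.

(** Differentiating [exp (lam w)] in [lam] brings down a factor [w], which lowers the index [k] of
    [w^(-k)] by one. *)
Lemma is_derive_moment_integrand (k phi lam t : R) :
  is_derive (fun lam => moment_integrand k phi lam t) lam (moment_integrand (k - 1) phi lam t).
Proof.
unfold moment_integrand. auto_derive; trivial.
replace (lam * sin t - (k - 1) * t + phi) with (lam * sin t - k * t + phi + t) by ring.
replace (lam * sin t + - (k * t) + phi) with (lam * sin t - k * t + phi) by ring.
rewrite (cos_plus _ t). ring.
Qed.

Lemma is_derive_moment (k phi lam : R) :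
  is_derive (fun lam => RInt (moment_integrand k phi lam) 0 (2 * PI)) lam
    (RInt (moment_integrand (k - 1) phi lam) 0 (2 * PI)).
Proof.
assert (E : forall lam t, Derive (fun z => moment_integrand k phi z t) lam
   = moment_integrand (k - 1) phi lam t).
{ intros. apply is_derive_unique, is_derive_moment_integrand. }
rewrite <- (RInt_ext (fun t => Derive (fun z => moment_integrand k phi z t) lam)) by (intros; apply E).
apply (is_derive_RInt_param (moment_integrand k phi)).
- apply filter_forall. intros l t _. eexists. apply is_derive_moment_integrand.
- intros t _. apply continuity_2d_pt_ext with (moment_integrand (k - 1) phi).
  + intros; symmetry; apply E.
  + apply moment_integrand_continuity.
- apply filter_forall. intros l. apply ex_RInt_moment_integrand.
Qed.

Lemma sin_period_Z (x : R) (m : Z) : sin (x + 2 * IZR m * PI) = sin x.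
Proof.
destruct (Z_le_dec 0 m) as [Hm | Hm].
- rewrite <- (Z2Nat.id m), <- INR_IZR_INZ by trivial. apply sin_period.
- rewrite <- (sin_period _ (Z.to_nat (- m))), INR_IZR_INZ, Z2Nat.id, opp_IZR by lia.
  f_equal. ring.
Qed.

(** At [lam = 0] the integrand is [cos (phi - m t)], whose antiderivative has period [2 PI]. *)
Lemma moment_0 (m : Z) (phi : R) :
  m <> 0%Z -> RInt (moment_integrand (IZR m) phi 0) 0 (2 * PI) = 0.
Proof.
intros Hm. apply eq_IZR_contrapositive in Hm.
apply is_RInt_unique.
replace 0 with (minus (- sin (phi - IZR m * (2 * PI)) / IZR m) (- sin (phi - IZR m * 0) / IZR m)) at 3.
2: { rewrite <- (sin_period_Z (phi - IZR m * (2 * PI)) m).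
  replace (phi - IZR m * (2 * PI) + 2 * IZR m * PI) with (phi - IZR m * 0) by ring.
  unfold minus, plus, opp; simpl. ring. }
apply (is_RInt_derive (fun t => - sin (phi - IZR m * t) / IZR m)).
- intros t _. unfold moment_integrand. auto_derive; trivial.
  rewrite !Rmult_0_l, exp_0.
  replace (0 - IZR m * t + phi) with (phi - IZR m * t) by ring.
  replace (phi + - (IZR m * t)) with (phi - IZR m * t) by ring. field; trivial.
- intros t _. apply (ex_derive_continuous (moment_integrand (IZR m) phi 0)).
  unfold moment_integrand. auto_derive; trivial.
Qed.

(** For [lam <> 0] the integrand is the real part of the [t]-derivative of
    [exp (i phi) exp (lam w) / (i lam)], which is periodic; for [lam = 0] it is covered by
    [moment_0]. *)
Lemma moment_minus_1 (phi lam : R) :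
  RInt (moment_integrand (-1) phi lam) 0 (2 * PI) = 0.
Proof.
destruct (Req_dec lam 0) as [-> | Hl].
{ apply (moment_0 (-1)). lia. }
apply is_RInt_unique.
replace 0 with (minus (exp (lam * cos (2 * PI)) * sin (lam * sin (2 * PI) + phi) / lam)
  (exp (lam * cos 0) * sin (lam * sin 0 + phi) / lam)) at 2.
2: { rewrite cos_2PI, sin_2PI, cos_0, sin_0. unfold minus, plus, opp; simpl. ring. }
apply (is_RInt_derive (fun t => exp (lam * cos t) * sin (lam * sin t + phi) / lam)).
- intros t _. unfold moment_integrand. auto_derive; trivial.
  replace (lam * sin t - -1 * t + phi) with (lam * sin t + phi + t) by ring.
  rewrite (cos_plus _ t). field; trivial.
- intros t _. apply (ex_derive_continuous (moment_integrand (-1) phi lam)).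
  unfold moment_integrand. auto_derive; trivial.
Qed.

Lemma eq_of_is_derive (f g df : R -> R) (x : R) :
  (forall x, is_derive f x (df x)) -> (forall x, is_derive g x (df x)) ->
  f 0 = g 0 -> f x = g x.
Proof.
intros Hf Hg E.
destruct (MVT_gen (fun x => f x - g x) 0 x (fun _ => 0)) as (c & _ & Hc).
- intros y _. replace 0 with (minus (df y) (df y)).
  + apply (is_derive_minus f g); trivial.
  + unfold minus, plus, opp; simpl; ring.
- intros y _. apply continuity_pt_minus; apply continuity_pt_filterlim;
    apply (ex_derive_continuous (V := R_NormedModule)); eexists; trivial.
- lra.
Qed.

(** This extracts the Taylor coefficient of [exp (lam w)] without expanding it. For [n > 0] both
    sides vanish at [lam = 0] and their derivatives in [lam] are the case [n - 1]; for [n = 0] the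
    derivative is the moment of index -1, which is 0. *)
Lemma moment (n : nat) (phi lam : R) :
  RInt (moment_integrand (INR n) phi lam) 0 (2 * PI)
  = 2 * PI * cos phi * lam ^ n / INR (fact n).
Proof.
revert lam. induction n as [|n IH]; intros lam.
- apply (eq_of_is_derive (fun lam => RInt (moment_integrand (INR 0) phi lam) 0 (2 * PI))
    (fun lam => 2 * PI * cos phi * lam ^ 0 / INR (fact 0)) (fun _ => 0)).
  + intros x. pose proof (is_derive_moment (INR 0) phi x) as D.
    replace (INR 0 - 1) with (-1) in D by (simpl; ring).
    rewrite moment_minus_1 in D. exact D.
  + intros x. simpl. auto_derive; trivial.
  + rewrite (RInt_ext _ (fun _ => cos phi)).
    * rewrite RInt_const. unfold scal; simpl; unfold mult; simpl. field.
    * intros t _. unfold moment_integrand. simpl.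
      rewrite !Rmult_0_l, exp_0. rewrite Rmult_1_l. f_equal. ring.
- apply (eq_of_is_derive (fun lam => RInt (moment_integrand (INR (S n)) phi lam) 0 (2 * PI))
    (fun lam => 2 * PI * cos phi * lam ^ S n / INR (fact (S n)))
    (fun lam => 2 * PI * cos phi * lam ^ n / INR (fact n))).
  + intros x. rewrite <- IH.
    replace (INR n) with (INR (S n) - 1) by (rewrite S_INR; ring). apply is_derive_moment.
  + intros x. rewrite fact_simpl, mult_INR. pose proof (INR_fact_neq_0 n) as F.
    assert (N : INR (S n) <> 0) by (apply not_0_INR; lia).
    generalize dependent (INR (fact n)). intros f _ F.
    auto_derive; trivial.
    change (Init.Nat.pred (S n)) with n. field; auto.
  + rewrite INR_IZR_INZ, moment_0 by lia. rewrite pow_i by lia. unfold Rdiv; ring.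
Qed.

(** * Dirichlet series *)

Lemma exp_le (x y : R) : x <= y -> exp x <= exp y.
Proof. intros [H | ->]; [left; now apply exp_increasing | apply Rle_refl]. Qed.

Lemma sum_n_nonneg (u : nat -> R) (n : nat) : (forall k, 0 <= u k) -> 0 <= sum_n u n.
Proof.
intros H. induction n as [|n IH]; [now rewrite sum_O |].
rewrite sum_Sn. now apply Rplus_le_le_0_compat.
Qed.

Lemma RInt_mult_l (f : R -> R) (a b c : R) :
  ex_RInt f a b -> RInt (fun t => c * f t) a b = c * RInt f a b.
Proof. apply (RInt_scal (V := R_CompleteNormedModule)). Qed.

Lemma exp_pow (x : R) (n : nat) : exp x ^ n = exp (INR n * x).
Proof.
induction n as [|n IH]; [simpl; now rewrite Rmult_0_l, exp_0 |].
rewrite S_INR, Rmult_plus_distr_r, exp_plus, <- IH, Rmult_1_l. simpl. ring.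
Qed.

Lemma Cmod_cexp (z : C) : Cmod (cexp z) = exp (Re z).
Proof.
unfold cexp, Cmod; simpl fst; simpl snd.
pose proof (sin2_cos2 (Im z)) as E. unfold Rsqr in E.
replace (_ + _) with (exp (Re z) * exp (Re z)) by nra.
apply sqrt_square. left; apply exp_pos.
Qed.

Lemma Cmod_dirichlet_term (a : nat -> C) (s : C) (j : nat) :
  Cmod (dirichlet_term a s j) = Cmod (a (S j)) * exp (- Re s * ln (INR (S j))).
Proof.
unfold dirichlet_term, npow_opp. rewrite Cmod_mult, Cmod_cexp.
do 2 f_equal. unfold Re. generalize (ln (INR (S j))). intros L. simpl. ring.
Qed.

Lemma ln_INR_S_pos (j : nat) : 0 <= ln (INR (S j)).
Proof.
rewrite <- ln_1. apply ln_le; [lra |]. rewrite S_INR. pose proof (pos_INR j). lra.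
Qed.

(** If absolute convergence failed at [s], then [Re s] would be a lower bound of the set whose
    infimum is the abscissa. *)
Lemma abs_convergent_right (a : nat -> C) (sigma : R) (s : C) :
  abscissa_abs a = Finite sigma -> sigma < Re s -> abs_convergent a s.
Proof.
intros Ha Hs. apply NNPP. intros Hn.
pose proof (Glb_Rbar_correct (fun sigma : R => forall s : C, sigma < Re s -> abs_convergent a s)) as [_ G].
fold (abscissa_abs a) in G. rewrite Ha in G.
specialize (G (Finite (Re s))). simpl in G. apply (Rlt_not_le _ _ Hs), G.
intros x Hx. simpl. apply Rnot_lt_le. intros Hlt. exact (Hn (Hx s Hlt)).
Qed.

(** Absolute convergence makes both [Series] in [dirichlet_series] true sums. The factor is meant
    for the kernel of a Fourier coefficient. *)
Lemma is_series_Re_mult_dirichlet (a : nat -> C) (s w : C) :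
  abs_convergent a s ->
  is_series (fun j => Re (dirichlet_term a s j * w)%C) (Re (dirichlet_series a s * w)%C).
Proof.
intros H.
assert (HR : is_series (fun j => Re (dirichlet_term a s j))
               (Series (fun j => Re (dirichlet_term a s j)))).
{ apply Series_correct. apply (ex_series_le (V := R_CompleteNormedModule) _ _) with (2 := H).
  intros n. apply Rabs_Re_Im_le_Cmod. }
assert (HI : is_series (fun j => Im (dirichlet_term a s j))
               (Series (fun j => Im (dirichlet_term a s j)))).
{ apply Series_correct. apply (ex_series_le (V := R_CompleteNormedModule) _ _) with (2 := H).
  intros n. apply Rabs_Re_Im_le_Cmod. }
eapply is_series_ext.
2: { exact (is_series_minus _ _ _ _ (is_series_scal_r (Re w) _ _ HR)
        (is_series_scal_r (Im w) _ _ HI)). }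
intros n. unfold minus, plus, opp; simpl. unfold Re, Im. ring.
Qed.

(** At [s = 1 + w] with [w = exp (x + i t)] and [L = ln n], the power [n^(-s)] is
    [exp (- L) exp (- L w)], hence [lam = - exp x * L]; [exp (- k x)] is the modulus of [w^(-k)]. *)
Lemma circle_term_moment_integrand (m theta L x t k : R) :
  Re (RtoC m * cexp (Ci * RtoC theta)
      * cexp (Copp (1 + exp (1 * x) * cos (1 * t), exp (1 * x) * sin (1 * t))%R * RtoC L)
      * (0 + exp (- k * x) * cos (- k * t), exp (- k * x) * sin (- k * t))%R)%C
  = m * exp (- L) * exp (- k * x) * moment_integrand k theta (- exp x * L) t.
Proof.
unfold moment_integrand. rewrite !Rmult_1_l.
set (A := exp x * cos t). set (B := exp x * sin t).
replace (- exp x * L * cos t) with (- (A * L)) by (unfold A; ring).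
replace (- exp x * L * sin t - k * t + theta) with (theta + - (B * L) + - k * t) by (unfold B; ring).
rewrite !cos_plus, sin_plus.
unfold cexp, Re, Im, Ci. simpl.
replace (0 * theta - 1 * 0) with 0 by ring. replace (0 * 0 + 1 * theta) with theta by ring.
replace (- (1 + A) * L - - B * 0) with (- L + - (A * L)) by ring.
replace (- (1 + A) * 0 + - B * L) with (- (B * L)) by ring.
rewrite exp_plus, exp_0. ring.
Qed.

(** For [x < 0] the circle lies in [Omega0], where [g] is the series and can be integrated term by
    term. In the power of [- exp x * L j] given by [moment], the radius cancels against
    [exp (- k x)], and the sign [(-1) ^ k] is moved to the other side. *)
Lemma is_series_circle_coefficient (a : nat -> C) (theta : nat -> R) (U : C -> Prop)
  (g : C -> C) (x : R) (k : nat) :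
  abscissa_abs a = Finite 0 ->
  (forall n : nat, (1 <= n)%nat ->
     a n = (RtoC (Cmod (a n)) * cexp (Ci * RtoC (theta n)))%C) ->
  holomorphic_on U g -> (forall s, Omega0 s -> U s) ->
  (forall s, Omega0 s -> g s = dirichlet_series a s) -> x < 0 ->
  is_series (fun j => 2 * PI * (Cmod (a (S j)) * cos (theta (S j)) * exp (- ln (INR (S j)))
                * ln (INR (S j)) ^ k / INR (fact k)))
    ((- 1) ^ k * RInt (circle_re g 1 (INR k) x) 0 (2 * PI)).
Proof.
intros Ha Ht Hg HU HgU Hx. pose proof PI_RGT_0 as HPI.
assert (He : exp x < 1) by (rewrite <- exp_0; apply exp_increasing; trivial).
pose proof (exp_pos x) as He0.
assert (HO : forall t, Omega0 (1 + exp x * cos t, exp x * sin t)).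
{ intros t. unfold Omega0; simpl. pose proof (COS_bound t). nra. }
pose (L j := ln (INR (S j))).
assert (HS : forall t, is_series (fun j => (Cmod (a (S j)) * exp (- L j) * exp (- INR k * x))
   * moment_integrand (INR k) (theta (S j)) (- exp x * L j) t) (circle_re g 1 (INR k) x t)).
{ intros t. unfold circle_re.
  rewrite HgU by (rewrite !Rmult_1_l; apply HO).
  eapply is_series_ext.
  2: { apply is_series_Re_mult_dirichlet. apply (abs_convergent_right _ 0); trivial.
    rewrite !Rmult_1_l; apply HO. }
  intros j. unfold dirichlet_term. rewrite (Ht (S j)) at 1 by lia.
  apply circle_term_moment_integrand. }
(* The dominating series is taken at [1 - exp x], the leftmost point of the circle, where every term
   is largest in modulus. *)
apply (is_series_RInt _ _ (fun j => Cmod (dirichlet_term a (RtoC (1 - exp x)) j)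
   * exp (- INR k * x)) 0 (2 * PI)) in HS.
- eapply is_series_ext; [| exact (is_series_scal_l ((-1) ^ k) _ _ HS)].
  intros j. cbv beta. rewrite RInt_mult_l by apply ex_RInt_moment_integrand.
  change (scal ((-1) ^ k) ?z) with ((-1) ^ k * z). rewrite moment.
  replace ((- exp x * L j) ^ k) with ((-1) ^ k * exp (INR k * x) * L j ^ k).
  2: { replace (- exp x * L j) with (-1 * (exp x * L j)) by ring.
    rewrite !Rpow_mult_distr, exp_pow. ring. }
  assert (E1 : (-1) ^ k * (-1) ^ k = 1).
  { rewrite <- Rpow_mult_distr. replace (-1 * -1) with 1 by ring. apply pow1. }
  assert (E2 : exp (- INR k * x) * exp (INR k * x) = 1).
  { rewrite <- exp_plus. rewrite <- exp_0. f_equal. ring. }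
  fold (L j). refine (_ : _ = _ :> R).
  transitivity (((-1) ^ k * (-1) ^ k) * (exp (- INR k * x) * exp (INR k * x)) *
    (2 * PI * (Cmod (a (S j)) * cos (theta (S j)) * exp (- L j) * L j ^ k / INR (fact k)))).
  + field. apply INR_fact_neq_0.
  + rewrite E1, E2. ring.
- lra.
- intros j. apply (ex_RInt_scal (V := R_NormedModule)), ex_RInt_moment_integrand.
- apply (ex_RInt_continuous (V := R_CompleteNormedModule)). intros t _.
  destruct (circle_cauchy_riemann U g 1 (INR k) x t Hg (HU _ (HO t))) as (al & be & D & _).
  exact (differentiable_continuous_r _ _ _ _ _ D).
- intros j t. rewrite Cmod_dirichlet_term. fold (L j).
  pose proof (ln_INR_S_pos j) as L0. fold (L j) in L0.
  rewrite !Rabs_mult, !(Rabs_pos_eq (exp _)), (Rabs_pos_eq (Cmod _))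
    by (apply Cmod_ge_0 || (left; apply exp_pos)).
  unfold moment_integrand. rewrite Rabs_mult, (Rabs_pos_eq (exp _)) by (left; apply exp_pos).
  simpl (Re _).
  replace (- (1 - exp x) * L j) with (- L j + exp x * L j) by ring. rewrite exp_plus.
  set (K := Cmod (a (S j)) * exp (- L j) * exp (- INR k * x)).
  replace (_ * exp (- INR k * x)) with (K * (exp (exp x * L j) * 1)) by (unfold K; ring).
  apply Rmult_le_compat_l.
  + repeat apply Rmult_le_pos; try (left; apply exp_pos). apply Cmod_ge_0.
  + apply Rmult_le_compat; [left; apply exp_pos | apply Rabs_pos | | apply Rabs_le, COS_bound].
    apply exp_le.
    replace (- exp x * L j * cos t) with (exp x * L j * - cos t) by ring.
    rewrite <- (Rmult_1_r (exp x * L j)) at 2.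
    apply Rmult_le_compat_l; [nra |]. pose proof (COS_bound t); lra.
- apply ex_series_scal_r. apply (abs_convergent_right _ 0); trivial. simpl. lra.
Qed.

(** On the circle [w^(-k)] has modulus [exp (- x) ^ k], so one [M] serves all [k]. *)
Lemma circle_RInt_bound (U : C -> Prop) (g : C -> C) (c x : R) :
  holomorphic_on U g -> (forall t, U (c + exp x * cos t, exp x * sin t)) ->
  exists M, forall k, Rabs (RInt (circle_re g c (INR k) x) 0 (2 * PI)) <= M * exp (- x) ^ k.
Proof.
intros Hg HU. pose proof PI_RGT_0 as HPI.
pose (G t := (g (c + exp (1 * x) * cos (1 * t), exp (1 * x) * sin (1 * t)))).
assert (CR : forall k t, continuous (circle_re g c k x) t /\ continuous (circle_im g c k x) t).
{ intros k t.
  destruct (circle_cauchy_riemann U g c k x t Hg (HU t)) as (al & be & D & D').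
  split; [exact (differentiable_continuous_r _ _ _ _ _ D)
         | exact (differentiable_continuous_r _ _ _ _ _ D')]. }
(* For index 0 the kernel is 1, so this is the integral of [|Re g| + |Im g|]. *)
exists (RInt (fun t => Rabs (circle_re g c 0 x t) + Rabs (circle_im g c 0 x t)) 0 (2 * PI)).
intros k.
assert (I1 : ex_RInt (circle_re g c (INR k) x) 0 (2 * PI)).
{ apply (ex_RInt_continuous (V := R_CompleteNormedModule)). intros; apply CR. }
assert (I2 : ex_RInt (fun t => Rabs (circle_re g c 0 x t) + Rabs (circle_im g c 0 x t)) 0 (2 * PI)).
{ apply (ex_RInt_continuous (V := R_CompleteNormedModule)). intros t _.
  apply (continuous_plus (V := R_NormedModule));
    apply (continuous_comp _ Rabs); try apply CR; apply continuous_Rabs. }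
eapply Rle_trans; [apply abs_RInt_le; [lra | trivial] |].
rewrite (Rmult_comm _ (exp (- x) ^ k)).
rewrite <- RInt_mult_l by exact I2.
apply RInt_le; [lra | | |].
- apply (ex_RInt_norm _ _ _ I1).
- apply (ex_RInt_scal (V := R_NormedModule)), I2.
- intros t _.
  assert (E : exp (- x) ^ k = exp (- INR k * x)).
  { rewrite exp_pow. f_equal. ring. }
  rewrite E. unfold circle_re, circle_im. fold (G t). clear - G.
  destruct (G t) as [p q]. unfold Re, Im; simpl.
  rewrite Ropp_0, !Rmult_0_l, exp_0, cos_0, sin_0.
  replace (p * (0 + 1 * 1) - q * (1 * 0)) with p by ring.
  replace (p * (1 * 0) + q * (0 + 1 * 1)) with q by ring.
  replace (p * _ - q * _) with
    (exp (- INR k * x) * (p * cos (- INR k * t) - q * sin (- INR k * t))) by ring.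
  rewrite Rabs_mult, Rabs_pos_eq by (left; apply exp_pos).
  apply Rmult_le_compat_l; [left; apply exp_pos |].
  eapply Rle_trans; [apply Rabs_triang |]. rewrite Rabs_Ropp, !Rabs_mult.
  assert (T : forall z, - 1 <= z <= 1 -> Rabs z <= 1) by (intros; now apply Rabs_le).
  pose proof (T _ (COS_bound (- INR k * t))). pose proof (T _ (SIN_bound (- INR k * t))).
  pose proof (Rabs_pos p). pose proof (Rabs_pos q). nra.
Qed.

(** If all moments [sum_j b_j L_j^k / k!] are [O(R^-k)], then summing against
    [y^k] for [y < R] and exchanging the two sums bounds [sum_j b_j exp (y L_j)]. *)
Lemma sum_exp_bounded (b L : nat -> R) (M R y : R) :
  (forall j, 0 <= b j) -> (forall j, 0 <= L j) -> 0 < y < R ->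
  (forall k n, sum_n (fun j => b j * L j ^ k / INR (fact k)) n <= M * (/ R) ^ k) ->
  forall n, sum_n (fun j => b j * exp (y * L j)) n <= M / (1 - y / R).
Proof.
intros Hb HL Hy H n.
assert (Hq : 0 <= y / R < 1).
{ split; [apply Rdiv_le_0_compat; lra |]. apply Rmult_lt_reg_r with R; [lra |].
  unfold Rdiv. rewrite Rmult_assoc, Rinv_l; lra. }
assert (S1 : is_series (fun k => M * (y / R) ^ k) (M / (1 - y / R))).
{ apply (is_series_scal_l M (fun k => (y / R) ^ k) (/ (1 - y / R))).
  apply is_series_geom. rewrite Rabs_pos_eq; lra. }
(* The sum over [j] stays finite, so exchanging it with the exponential series is mere additivity of
   convergent series. *)
assert (S2 : is_series (fun k => sum_n (fun j => b j * (y * L j) ^ k / INR (fact k)) n)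
   (sum_n (fun j => b j * exp (y * L j)) n)).
{ assert (T : forall j, is_series (fun k => b j * (y * L j) ^ k / INR (fact k))
     (b j * exp (y * L j))).
  { intros j. eapply is_series_ext.
    2: { exact (is_series_scal_l (b j) _ (exp (y * L j)) (is_exp_Reals (y * L j))). }
    intros k. unfold scal; simpl; unfold mult; simpl.
    rewrite pow_n_pow. unfold Rdiv; ring. }
  clear - T. induction n as [|n IH].
  - rewrite sum_O. eapply is_series_ext; [| apply T]. intros k; now rewrite sum_O.
  - rewrite sum_Sn. eapply is_series_ext; [| apply (is_series_plus _ _ _ _ IH (T (S n)))].
    intros k; now rewrite sum_Sn. }
rewrite <- (is_series_unique _ _ S1), <- (is_series_unique _ _ S2).
apply Series_le; [| eexists; exact S1].
intros k. split.
- apply sum_n_nonneg. intros j. specialize (HL j).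
  apply Rdiv_le_0_compat; [| apply INR_fact_lt_0].
  apply Rmult_le_pos; trivial. apply pow_le. nra.
- specialize (H k n).
  replace (sum_n _ n) with (y ^ k * sum_n (fun j => b j * L j ^ k / INR (fact k)) n).
  2: { rewrite <- (sum_n_mult_l (y ^ k)). apply sum_n_ext. intros j.
    unfold mult; simpl. rewrite Rpow_mult_distr. unfold Rdiv; ring. }
  unfold Rdiv. rewrite Rpow_mult_distr.
  replace (M * (y ^ k * (/ R) ^ k)) with (y ^ k * (M * (/ R) ^ k)) by ring.
  apply Rmult_le_compat_l; trivial. apply pow_le; lra.
Qed.

(** A nonnegative series with bounded partial sums converges, and a larger real part only shrinks
    the terms since [ln n >= 0]. *)
Lemma abscissa_abs_le (a : nat -> C) (sigma M : R) :
  (forall n, sum_n (fun j => Cmod (a (S j)) * exp (- sigma * ln (INR (S j)))) n <= M) ->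
  Rbar_le (abscissa_abs a) sigma.
Proof.
intros H. apply Glb_Rbar_correct. intros s Hs.
assert (E : ex_series (fun j => Cmod (a (S j)) * exp (- sigma * ln (INR (S j))))).
{ destruct (ex_finite_lim_seq_incr
    (sum_n (fun j => Cmod (a (S j)) * exp (- sigma * ln (INR (S j))))) M) as [l Hl]; trivial.
  - intros n. rewrite sum_Sn.
    rewrite <- (Rplus_0_r (sum_n _ n)) at 1. apply Rplus_le_compat_l.
    apply Rmult_le_pos; [apply Cmod_ge_0 | left; apply exp_pos].
  - exists l. exact Hl. }
apply (ex_series_le (V := R_CompleteNormedModule) _ _) with (2 := E).
intros j. change (Rabs (Cmod (dirichlet_term a s j))
  <= Cmod (a (S j)) * exp (- sigma * ln (INR (S j)))).
rewrite Rabs_pos_eq, Cmod_dirichlet_term by apply Cmod_ge_0.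
apply Rmult_le_compat_l; [apply Cmod_ge_0 |].
apply exp_le, Rmult_le_compat_r; [apply ln_INR_S_pos | lra].
Qed.

(** By the law of cosines, a disc around [1] of radius [sqrt (1 + r^2 / 2)]
    meets the closed left half-plane only inside the disc of radius [r] around [0]. *)
Lemma disc_subset (r rho t : R) :
  0 < r -> 0 <= rho -> rho ^ 2 <= 1 + r ^ 2 / 2 ->
  Omega0 (1 + rho * cos t, rho * sin t) \/ Cmod (1 + rho * cos t, rho * sin t) < r.
Proof.
intros Hr H0 H. destruct (Rlt_le_dec 0 (1 + rho * cos t)) as [Hp | Hn]; [now left | right].
unfold Cmod; simpl fst; simpl snd.
rewrite <- (sqrt_pow2 r) by lra.
pose proof (sin2_cos2 t) as E. unfold Rsqr in E.
apply sqrt_lt_1_alt. split; [nra |].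
replace ((1 + rho * cos t) ^ 2 + (rho * sin t) ^ 2)
  with (1 + 2 * (rho * cos t) + rho ^ 2 * (sin t * sin t + cos t * cos t)) by ring.
(* By [Hn], [2 rho cos t <= -2], so the sum is at most [rho^2 - 1 <= r^2 / 2 < r^2]. *)
rewrite E. nra.
Qed.

Theorem theorem2 (a : nat -> C) (theta : nat -> R)
    (habs : abscissa_abs a = Finite 0)
    (htheta : forall n : nat, (1 <= n)%nat ->
       a n = (RtoC (Cmod (a n)) * cexp (Ci * RtoC (theta n)))%C)
    (hcos : exists gamma : R, 0 < gamma /\
       forall n : nat, (1 <= n)%nat -> gamma <= cos (theta n)) :
  ~ extends_holomorphically_at_0 (dirichlet_series a).
Proof.
intros (r & Hr & g & Hg & Hga). destruct hcos as (gamma & Hgamma & Hcos).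
set (U := fun s : C => Omega0 s \/ Cmod s < r) in Hg.
pose proof PI_RGT_0 as HPI.
pose (R := sqrt (1 + r ^ 2 / 2)).
assert (HR2 : R ^ 2 = 1 + r ^ 2 / 2) by (apply pow2_sqrt; nra).
assert (HR0 : 0 <= R) by apply sqrt_pos.
assert (HR : 1 < R) by nra.
assert (HUc : forall x t, x <= ln R -> U (1 + exp x * cos t, exp x * sin t)).
{ intros x t Hx. apply disc_subset; trivial; [left; apply exp_pos |].
  rewrite <- HR2. apply pow_incr. split; [left; apply exp_pos |].
  rewrite <- (exp_ln R) by lra. apply exp_le; trivial. }
destruct (circle_RInt_bound U g 1 (ln R) Hg (fun t => HUc _ t (Rle_refl _))) as [M HM].
assert (HlnR : 0 < ln R) by (rewrite <- ln_1; apply ln_increasing; lra).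
pose (L j := ln (INR (S j))).
assert (HL : forall j, 0 <= L j) by apply ln_INR_S_pos.
pose (b j := Cmod (a (S j)) * cos (theta (S j)) * exp (- L j)).
(* The hypothesis on the cosines enters here: it makes [b j] nonnegative and lets it control
   [|a_n| / n] up to the factor [gamma]. *)
assert (Hb : forall j, gamma * (Cmod (a (S j)) * exp (- L j)) <= b j).
{ intros j. unfold b.
  replace (Cmod (a (S j)) * cos (theta (S j)) * exp (- L j))
    with (cos (theta (S j)) * (Cmod (a (S j)) * exp (- L j))) by ring.
  apply Rmult_le_compat_r; [| apply Hcos; lia].
  apply Rmult_le_pos; [apply Cmod_ge_0 | left; apply exp_pos]. }
assert (Hb0 : forall j, 0 <= b j).
{ intros j. eapply Rle_trans; [| apply Hb].
  repeat apply Rmult_le_pos; try apply Cmod_ge_0; left; [trivial | apply exp_pos]. }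
assert (Hmom : forall k n,
  sum_n (fun j => b j * L j ^ k / INR (fact k)) n <= M / (2 * PI) * (/ R) ^ k).
{ intros k n.
  (* The moments are read off on the circle of radius [exp (-1) < 1]; the integral is then carried
     to the radius [R]. *)
  pose proof (is_series_circle_coefficient a theta U g (-1) k habs htheta Hg
    (fun s H => or_introl H) Hga ltac:(lra)) as HS.
  rewrite (circle_RInt_invariant U g 1 (-1) (ln R) k) in HS; [| lra | trivial |].
  2: { intros x t Hx. apply HUc. lra. }
  apply (is_series_sum_n_le _ _ n) in HS.
  2: { intros j. specialize (Hb0 j). fold (L j). specialize (HL j).
    apply Rmult_le_pos; [lra |].
    apply Rdiv_le_0_compat; [| apply INR_fact_lt_0].
    apply Rmult_le_pos; [exact Hb0 | now apply pow_le]. }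
  rewrite (sum_n_mult_l (2 * PI)) in HS. change (mult ?x ?y) with (x * y) in HS.
  specialize (HM k). rewrite exp_Ropp, exp_ln in HM by lra.
  apply Rmult_le_reg_l with (2 * PI); [lra |].
  replace (2 * PI * (M / (2 * PI) * (/ R) ^ k)) with (M * (/ R) ^ k) by (field; lra).
  eapply Rle_trans; [exact HS |]. eapply Rle_trans; [| exact HM].
  eapply Rle_trans; [apply Rle_abs |]. rewrite Rabs_mult, <- RPow_abs, Rabs_m1.
  rewrite pow1, Rmult_1_l. apply Rle_refl. }
(* The midpoint lies below [R], for the geometric series to converge, and above 1, for [1 - y] to be
   negative. *)
pose (y := (1 + R) / 2).
pose proof (sum_exp_bounded b L _ R y Hb0 HL ltac:(unfold y; lra) Hmom) as HB.
assert (A : Rbar_le (abscissa_abs a) (1 - y)).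
{ apply abscissa_abs_le with (M / (2 * PI) / (1 - y / R) / gamma). intros n.
  apply Rmult_le_reg_l with gamma; trivial.
  replace (gamma * (M / (2 * PI) / (1 - y / R) / gamma))
    with (M / (2 * PI) / (1 - y / R)) by (field; unfold y; repeat split; lra).
  eapply Rle_trans; [| apply (HB n)].
  change (gamma * ?z) with (mult gamma z). rewrite <- (sum_n_mult_l gamma).
  apply sum_n_m_le. intros j. fold (L j).
  change (gamma * (Cmod (a (S j)) * exp (- (1 - y) * L j)) <= b j * exp (y * L j)).
  (* The weight [1 / n] in [b j] combines with [n^y] to [n^(-(1 - y))], the power at the real point
     [1 - y]. *)
  replace (- (1 - y) * L j) with (- L j + y * L j) by ring. rewrite exp_plus.
  rewrite <- !Rmult_assoc. rewrite (Rmult_assoc gamma).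
  apply Rmult_le_compat_r; [left; apply exp_pos | apply Hb]. }
rewrite habs in A. simpl in A. unfold y in A. lra.
Qed.
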